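(* Let $X$ be a finite set and let $\mathrm{FIM}_X$ be the free inverse monoid generated by $X$. Then $\mathcal{H}\text{-}\mathrm{Geo}(\mathrm{FIM}_X)=\mathrm{Geo}(\mathrm{FIM}_X)$ is a context-free language.
   Context: $\tilde X=X\cup X^{-1}$ with $X^{-1}=\{x^{-1}:x\in X\}$ a disjoint copy of $X$; $\pi:\tilde X^*\to \mathrm{FIM}_X$ is the canonical surjective homomorphism; $\ell(w)$ is the length of the word $w$. With $\mathcal{H}$ Green's relation on $\mathrm{FIM}_X$, $$\mathcal{H}\text{-}\mathrm{Geo}(\mathrm{FIM}_X)=\bigl\{w\in\tilde X^*: \ell(w)=\min\{\ell(u): u\in\tilde X^*,\ (u\pi)\,\mathcal{H}\,(w\pi)\}\bigr\},$$ $$\mathrm{Geo}(\mathrm{FIM}_X)=\bigl\{w\in\tilde X^*: \ell(w)=\min\{\ell(u): u\in\tilde X^*,\ u\pi=w\pi\}\bigr\}.$$ *)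

(* Defs.v *)
From HB Require Import structures.
From Stdlib Require Import Relation_Operators.
From mathcomp Require Import all_boot.
From mathcomp Require Import boolp classical_sets.

Set Implicit Arguments.
Unset Strict Implicit.
Unset Printing Implicit Defensive.

Local Open Scope classical_set_scope.
Local Open Scope quotient_scope.

Section FreeInverseMonoid.
Variable X : choiceType.

(* The alphabet is X + X: [inl x] is the letter x and [inr x] is x^-1. *)
Definition word := seq (X + X).

Definition inv_letter (a : X + X) : X + X :=
  match a with inl x => inr x | inr x => inl x end.

Definition inv_word (w : word) : word := rev (map inv_letter w).

(* Vagner's congruence: the congruence on the free monoid [word] generated by
   u u^-1 u = u and u u^-1 v v^-1 = v v^-1 u u^-1. *)
Inductive vagner : word -> word -> Prop :=
| vagner_refl u : vagner u u
| vagner_sym u v : vagner u v -> vagner v u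
| vagner_trans u v w : vagner u v -> vagner v w -> vagner u w
| vagner_cat u u' v v' : vagner u u' -> vagner v v' -> vagner (u ++ v) (u' ++ v')
| vagner_regular u : vagner (u ++ inv_word u ++ u) u
| vagner_comm u v :
    vagner (u ++ inv_word u ++ v ++ inv_word v)
           (v ++ inv_word v ++ u ++ inv_word u).

Definition vagnerb : rel word := fun u v => `[< vagner u v >].

Fact vagnerb_refl : reflexive vagnerb.
Proof. by move=> u; apply/asboolP/vagner_refl. Qed.

Fact vagnerb_sym : symmetric vagnerb.
Proof. by move=> u v; apply/asboolP/asboolP; apply: vagner_sym. Qed.

Fact vagnerb_trans : transitive vagnerb.
Proof.
by move=> v u w /asboolP uv /asboolP vw; apply/asboolP/(vagner_trans uv).
Qed.

Canonical vagner_equiv :=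
  EquivRel vagnerb vagnerb_refl vagnerb_sym vagnerb_trans.

Definition FIM : Type := {eq_quot vagner_equiv}.
HB.instance Definition _ := Choice.on FIM.

Definition FIM_pi (w : word) : FIM := \pi_{eq_quot vagner_equiv} w.

Lemma FIM_piP u v : FIM_pi u = FIM_pi v <-> vagner u v.
Proof.
split=> [/(@eqmodP _ vagner_equiv)/asboolP // | uv].
by apply/(@eqmodP _ vagner_equiv)/asboolP.
Qed.

Lemma FIM_pi_surj (m : FIM) : exists w, FIM_pi w = m.
Proof. by exists (repr (m : {eq_quot vagner_equiv})); exact: reprK. Qed.

Definition FIM_mul (m n : FIM) : FIM :=
  FIM_pi (repr (m : {eq_quot vagner_equiv}) ++
          repr (n : {eq_quot vagner_equiv})).

Lemma FIM_pi_cat u v : FIM_pi (u ++ v) = FIM_mul (FIM_pi u) (FIM_pi v).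
Proof.
by apply/FIM_piP/vagner_cat; apply/FIM_piP; rewrite /FIM_pi reprK.
Qed.

Fact FIM_mulA : associative FIM_mul.
Proof.
move=> m n p; have [u <-] := FIM_pi_surj m; have [v <-] := FIM_pi_surj n.
by have [w <-] := FIM_pi_surj p; rewrite -!FIM_pi_cat catA.
Qed.

Fact FIM_mul1 : left_id (FIM_pi [::]) FIM_mul.
Proof. by move=> m; have [u <-] := FIM_pi_surj m; rewrite -FIM_pi_cat. Qed.

Fact FIM_mulr1 : right_id (FIM_pi [::]) FIM_mul.
Proof.
by move=> m; have [u <-] := FIM_pi_surj m; rewrite -FIM_pi_cat cats0.
Qed.

HB.instance Definition _ := isMonoid.Build FIM FIM_mulA FIM_mul1 FIM_mulr1.

Lemma FIM_pi1 : FIM_pi [::] = 1%g.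
Proof. by []. Qed.

Lemma FIM_piM u v : FIM_pi (u ++ v) = (FIM_pi u * FIM_pi v)%g.
Proof. exact: FIM_pi_cat. Qed.

End FreeInverseMonoid.

Section Green.
Variable M : monoidType.

Definition green_R (a b : M) : Prop :=
  [set (a * x)%g | x in [set: M]] = [set (b * x)%g | x in [set: M]].

Definition green_L (a b : M) : Prop :=
  [set (x * a)%g | x in [set: M]] = [set (x * b)%g | x in [set: M]].

Definition green_H (a b : M) : Prop := green_R a b /\ green_L a b.

End Green.

Definition is_min (A : set nat) (m : nat) : Prop :=
  A m /\ forall k, A k -> m <= k.

Definition Geo (X : choiceType) : set (word X) :=
  [set w | is_min [set size u | u in [set u : word X | FIM_pi u = FIM_pi w]]
             (size w)].

Definition HGeo (X : choiceType) : set (word X) :=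
  [set w | is_min
             [set size u | u in [set u : word X | green_H (FIM_pi u) (FIM_pi w)]]
             (size w)].

Arguments Geo X : clear implicits.
Arguments HGeo X : clear implicits.

Record cfg (T : Type) := Cfg {
  cfg_nonterm : finType;
  cfg_start : cfg_nonterm;
  cfg_prods : seq (cfg_nonterm * seq (cfg_nonterm + T))
}.

Section ContextFree.
Variables (T : eqType) (G : cfg T).

Inductive cfg_step : seq (cfg_nonterm G + T) -> seq (cfg_nonterm G + T) -> Prop :=
| CfgStep A r s t : (A, r) \in cfg_prods G ->
    cfg_step (s ++ inl A :: t) (s ++ r ++ t).

Definition cfg_derives := clos_refl_trans (seq (cfg_nonterm G + T)) cfg_step.

Definition cfg_language : set (seq T) :=
  [set w | cfg_derives [:: inl (cfg_start G)] (map inr w)].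

End ContextFree.

Definition context_free (T : finType) (L : set (seq T)) : Prop :=
  exists G : cfg T, cfg_language G = L.

(* Main.v *)
Require Import Defs.
From Stdlib Require Import Relation_Operators.
From mathcomp Require Import all_boot zify.
From mathcomp Require Import boolp classical_sets.

Set Implicit Arguments.
Unset Strict Implicit.
Unset Printing Implicit Defensive.

(** A word labels a walk from the identity in the Cayley tree of the free group
on X.  The end point of the walk and the set of vertices it visits depend only
on the element of the free inverse monoid ([vagner_act_trace]); this is the
easy half of Munn's theorem.

A walk that visits n vertices and ends at distance h from the identity has
length at least 2(n-1) - h ([trace_lower_bound]): each edge of the visited
subtree must be crossed, and crossed twice unless it separates the two end
points.  Equality holds exactly when no edge is crossed three times.  Such
walks have a recursive shape ([geodesic_walk]).  At a vertex with a set A of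
edges still free to cross, either stop, or choose an edge a of A, make a closed
excursion behind it, come back and go on with the edges of A other than a, or
choose a and leave along it for good.  As A ranges over the subsets of a finite
alphabet, this recursion is a context-free grammar.

Geodesics have this shape ([Geo_geodesic_walk]).  A suffix of a geodesic is a
geodesic, so one adds letters on the left.  If adding a to a walk of the right
shape destroys the shape, the edge of a is crossed three times, and the word
is a d a^-1 e a p with d and e idempotent; commuting idempotents makes it equal
to the shorter word e a d p ([vagner_shorten]).

Walks of this shape are minimal even in their H-class, because H-related
elements have the same vertex set and end point ([green_H_act_trace]).  Relation
R gives the equality of vertex sets.  Relation L then gives an element x of the
free group, carrying one end point to the other, whose powers all lie in the
finite vertex set; as the free group is torsion-free
([bounded_powers_trivial]), x is trivial.  Hence the geodesics, the H-geodesics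
and the words of the grammar are the same. *)

(** * Walks in the Cayley tree of the free group *)

Section Walks.
Variable X : choiceType.
Local Notation letter := (X + X)%type.
Implicit Types (a b : letter) (s t : seq letter) (u v w p q c : word X).

Lemma inv_letterK : involutive (@inv_letter X).
Proof. by case. Qed.

Lemma inv_letter_neq a : inv_letter a != a.
Proof. by case: a. Qed.

Lemma inv_word_cons a u : inv_word (a :: u) = rcons (inv_word u) (inv_letter a).
Proof. by rewrite /inv_word /= rev_cons. Qed.

Lemma inv_word_cat u v : inv_word (u ++ v) = inv_word v ++ inv_word u.
Proof. by rewrite /inv_word map_cat rev_cat. Qed.

Lemma inv_wordK : involutive (@inv_word X).
Proof. by move=> u; rewrite /inv_word map_rev revK mapK //; exact: inv_letterK. Qed.

Definition noncancel : rel letter := fun a b => a != inv_letter b.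

Lemma noncancel_sym : symmetric noncancel.
Proof.
by move=> a b; rewrite /noncancel -(inj_eq (can_inj inv_letterK)) inv_letterK eq_sym.
Qed.

Definition reduced s : bool := sorted noncancel s.

Lemma reduced_rev s : reduced (rev s) = reduced s.
Proof.
rewrite /reduced rev_sorted; apply: eq_sorted => a b.
by rewrite noncancel_sym.
Qed.

(** A vertex is a reduced word stored as a stack, last letter first, so that
crossing an edge pushes or pops one letter.  The neighbour of a vertex on the
way to the identity is its tail, and the subtree behind it consists of the
lists that have it as a suffix. *)
Definition step s a : seq letter :=
  if s is b :: s' then if b == inv_letter a then s' else a :: s else [:: a].

Definition act s w : seq letter := foldl step s w.

Definition trace s w : seq (seq letter) := s :: scanl step s w.

Lemma act_cat s u v : act s (u ++ v) = act (act s u) v.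
Proof. exact: foldl_cat. Qed.

Lemma act_rcons s u a : act s (rcons u a) = step (act s u) a.
Proof. by rewrite /act foldl_rcons. Qed.

Lemma mem_trace_cons s a w t :
  (t \in trace s (a :: w)) = (t == s) || (t \in trace (step s a) w).
Proof. by []. Qed.

Lemma mem_trace_start s w : s \in trace s w.
Proof. exact: mem_head. Qed.

Lemma mem_trace_cat s u v t :
  (t \in trace s (u ++ v)) = (t \in trace s u) || (t \in trace (act s u) v).
Proof.
elim: u s => [|a u IH] s /=.
  by rewrite [t \in trace s [::]]inE; case: eqP => // ->; rewrite mem_trace_start.
by rewrite !mem_trace_cons IH orbA.
Qed.

Lemma reduced_step s a : reduced s -> reduced (step s a).
Proof.
case: s => [|b s] //= bs; case: ifPn => [_ | ba]; first exact: path_sorted bs.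
by rewrite /= noncancel_sym /noncancel ba.
Qed.

Lemma reduced_act s w : reduced s -> reduced (act s w).
Proof. by elim: w s => //= a w IH s rs; apply/IH/reduced_step. Qed.

Lemma stepK s a : reduced s -> step (step s a) (inv_letter a) = s.
Proof.
case: s => [|b s]; first by rewrite /= inv_letterK eqxx.
move=> rbs /=; case: eqP => [ba | _]; last by rewrite /= inv_letterK eqxx.
subst b; case: s rbs => [|c s] //= /andP[ac _].
by rewrite inv_letterK; case: eqP ac => // <-; rewrite /noncancel eqxx.
Qed.

Lemma act_inv s u : reduced s -> act (act s u) (inv_word u) = s.
Proof.
elim: u s => //= a u IH s rs.
by rewrite inv_word_cons act_rcons IH ?stepK ?reduced_step.
Qed.

(** The walk labelled by the inverse word runs through the same vertices
backwards. *)
Lemma trace_inv s u : reduced s -> trace (act s u) (inv_word u) =i trace s u.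
Proof.
elim: u s => //= a u IH s rs t; have rsa := reduced_step a rs.
rewrite inv_word_cons -cats1 mem_trace_cat IH // act_inv //.
rewrite !mem_trace_cons stepK // orbC [t \in trace s [::]]inE.
case: (t =P step s a) => //= ->; by rewrite mem_trace_start orbT.
Qed.

(** Both sides of each defining relation retrace the same paths: a word of the
form u u^-1 is a closed walk over the vertices of u. *)
Lemma vagner_act_trace u v : vagner u v ->
  forall s, reduced s -> act s u = act s v /\ trace s u =i trace s v.
Proof.
elim=> {u v} [u|u v _ IH|u v w _ IH1 _ IH2|u u' v v' _ IHu _ IHv|u|u v] s rs.
- by [].
- by case: (IH s rs) => -> tr; split=> // t; rewrite tr.
- case: (IH1 s rs) => -> e1; case: (IH2 s rs) => -> e2.
  by split=> // t; rewrite e1 e2.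
- case: (IHu s rs) => eu tu; case: (IHv (act s u) (reduced_act _ rs)) => ev tv.
  by split=> [|t]; rewrite ?act_cat ?mem_trace_cat -eu // tu tv.
- split=> [|t]; first by rewrite !act_cat act_inv.
  by rewrite !mem_trace_cat trace_inv // act_inv // orbb orbb.
- split=> [|t]; first by rewrite !act_cat !act_inv.
  rewrite !mem_trace_cat !act_inv // !trace_inv //.
  by case: (t \in trace s u); case: (t \in trace s v).
Qed.

Lemma trace_size s w t : t \in trace s w -> size t <= size s + size w.
Proof.
elim: w s => [|a w IH] s; first by rewrite inE => /eqP->; rewrite leq_addr.
rewrite mem_trace_cons => /predU1P[->|/IH]; first by rewrite leq_addr.
move/leq_trans; apply; rewrite /= addnS -addSn leq_add2r.
by case: s => //= b s; case: ifP => _ //=; lia.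
Qed.

(** The list V collects the vertices already seen, an ancestor-closed set.  A
push adds at most one vertex to it, and pays 2 for it: one letter and one unit
of height.  A pop spends a letter against a unit of height and discovers
nothing, since the vertex below is an ancestor. *)
Lemma trace_lower_bound w s (V : seq (seq letter)) :
    (forall t s', s = t ++ s' -> s' \in V) ->
  exists V' : seq (seq letter), [/\ {subset V <= V'}, {subset trace s w <= V'} &
    2 * size V' + size s <= 2 * size V + size w + size (act s w)].
Proof.
elim: w s V => [|a w IH] s V sufV.
  exists V; split=> [//|t|/=]; last by lia.
  by rewrite inE => /eqP->; apply: (sufV [::]).
have sV : s \in V by apply: (sufV [::]).
have [V1 [VV1 closed1 size1]] : exists V1 : seq (seq letter), [/\ {subset V <= V1},
    forall t s', step s a = t ++ s' -> s' \in V1 &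
    2 * size V1 + size s <= 2 * size V + size (step s a) + 1].
  have push : exists V1 : seq (seq letter), [/\ {subset V <= V1},
    forall t s', a :: s = t ++ s' -> s' \in V1 &
    2 * size V1 + size s <= 2 * size V + size (a :: s) + 1].
    exists ((a :: s) :: V); split=> [t tV|[|b t] s'|/=]; last by lia.
    - by rewrite inE tV orbT.
    - by move=> /= <-; rewrite mem_head.
    - by case=> _ /sufV; rewrite inE orbC => ->.
  case: s sufV sV push => [|b s] //= sufV sV push; case: ifP => _ //.
  by exists V; split=> [//|t s' est|]; [apply: (sufV (b :: t)); rewrite est | lia].
have [V' [V1V' trV' size']] := IH _ _ closed1.
exists V'; split=> [t /VV1/V1V' // | t | /=]; last by lia.
by rewrite mem_trace_cons => /predU1P[->|/trV' //]; apply/V1V'/VV1.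
Qed.

(** A duplicate-free list of visited vertices that attains the lower bound
certifies that no walk with the same vertices and end point is shorter. *)
Lemma geodesic_certificate u w (V : seq (seq letter)) :
    act [::] u = act [::] w -> trace [::] u =i trace [::] w ->
    uniq V -> {subset V <= trace [::] w} ->
    2 * size V = size w + size (act [::] w) + 2 ->
  size w <= size u.
Proof.
move=> eq_act eq_trace uniqV subV sizeV.
have [|V' [_ trV' sizeV']] := @trace_lower_bound u [::] [:: [::]].
  by case=> [|a t] s' //= <-; rewrite mem_head.
have : size V <= size V'.
  by apply: uniq_leq_size => // t /subV; rewrite -eq_trace => /trV'.
by move: sizeV'; rewrite eq_act /=; lia.
Qed.

(** * The free group is torsion-free *)

Lemma act_reduced w s : reduced (catrev w s) -> act s w = catrev w s.
Proof.
elim: w s => //= a w IH s rws.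
have red_suffix q t : reduced (catrev q t) -> reduced t.
  rewrite catrevE /reduced; case: (rev q) => //= b r.
  by rewrite cat_path => /andP[_ /path_sorted].
have -> : step s a = a :: s; last exact: IH.
case: s rws => [|b s] // /red_suffix /= /andP[].
by rewrite noncancel_sym /noncancel => /negbTE ->.
Qed.

(** The action of a word is the action of its reduced form, which is the stack
it reaches from the identity read from the bottom. *)
Lemma act_reduction s w : reduced s -> act s (rev (act [::] w)) = act s w.
Proof.
move=> rs; elim/last_ind: w => // w a IH; rewrite !act_rcons -IH.
case: (act [::] w) => [|b t] //=; case: eqP => [-> | _].
  have := stepK (inv_letter a) (reduced_act (rev t) rs).
  by rewrite inv_letterK rev_cons act_rcons => ->.
by rewrite !rev_cons !act_rcons.
Qed.

Lemma reduced_glue p q w : q != [::] ->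
  reduced (p ++ q) -> reduced (q ++ w) -> reduced (p ++ q ++ w).
Proof.
case: q => // b q _; rewrite /reduced; case: p => //= a p.
by rewrite !(cat_path _ _ p) /= => /and3P[-> -> _] ->.
Qed.

Lemma reduced_cat p q a b :
  reduced (rcons p b) -> reduced (a :: q) -> noncancel b a ->
  reduced (rcons p b ++ a :: q).
Proof.
by rewrite /reduced; case: p => [|c p] /= pb aq ba;
  rewrite ?cat_path ?pb ?last_rcons /= ba.
Qed.

(** Strip matching inverse letters from the two ends of w until the first and
the last letters no longer cancel; a nonempty core remains because adjacent
letters of w do not cancel. *)
Lemma cyclic_reduction w : reduced w -> w != [::] ->
  exists p c, [/\ w = p ++ c ++ inv_word p, c != [::] & reduced (c ++ c)].
Proof.
have [n] := ubnP (size w); elim: n w => // n IH [|a w] // wn raw _.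
case/lastP: w wn raw => [|m b] wn raw.
  exists [::], [:: a]; split=> //=.
  by rewrite /reduced /= /noncancel eq_sym inv_letter_neq.
have [ba | ba] := boolP (noncancel b a).
  exists [::], (a :: rcons m b); rewrite cats0; split=> //.
  by rewrite -rcons_cons; apply: reduced_cat; rewrite // rcons_cons.
move: ba; rewrite negbK => /eqP def_b; subst b.
move: raw; rewrite /reduced /= rcons_path => /andP[am last_m].
have m0 : m != [::].
  by case: m last_m {wn am} => //=; rewrite noncancel_sym /noncancel eqxx.
have rm : reduced m by apply: path_sorted am.
have [|p [c [def_m c0 rcc]]] := IH m _ rm m0.
  by move: wn; rewrite /= size_rcons; lia.
exists (a :: p), c; split=> //.
by rewrite inv_word_cons def_m -!cats1 -!catA.
Qed.

Lemma reduced_conj_power p c q n : c != [::] ->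
    reduced (c ++ c) -> reduced (p ++ c ++ q) ->
  reduced (p ++ flatten (nseq n.+1 c) ++ q).
Proof.
move=> c0 rcc rpcq; have rcq : reduced (c ++ q).
  move: rpcq; rewrite /reduced; case: p => // a p; rewrite /= cat_path.
  by case/andP=> _ /path_sorted.
have rpc : reduced (p ++ c).
  move: rpcq; rewrite /reduced catA; case: (p ++ c) => //= a r.
  by rewrite cat_path => /andP[].
(* Nonempty c is what carries reducedness across each junction. *)
have rcnq : reduced (flatten (nseq n.+1 c) ++ q).
  elim: n => [|n IH]; first by rewrite /= cats0.
  by move: IH; rewrite /= -!catA; apply: reduced_glue.
by rewrite /= -catA; apply: reduced_glue; rewrite // catA.
Qed.

Lemma act_conj_power s p c n : reduced s ->
  act s (flatten (nseq n (p ++ c ++ inv_word p))) =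
  act s (p ++ flatten (nseq n c) ++ inv_word p).
Proof.
elim: n s => [|n IH] s rs; first by rewrite act_cat act_inv.
rewrite /= act_cat IH ?reduced_act // !act_cat.
by rewrite -{3}[p]inv_wordK act_inv ?reduced_act.
Qed.

(** If the reduced form of x is p c p^-1 with c cyclically reduced and nonempty,
then p c^n p^-1 is the reduced form of x^n, of length at least n. *)
Lemma bounded_powers_trivial x (N : nat) :
  (forall n, size (act [::] (flatten (nseq n x))) <= N) -> act [::] x = [::].
Proof.
move=> bounded; apply/eqP/negPn/negP => x_neq1.
pose k := rev (act [::] x).
have rk : reduced k by rewrite reduced_rev; apply: reduced_act.
have k0 : k != [::] by rewrite -size_eq0 size_rev size_eq0.
have act_k n s : reduced s ->
    act s (flatten (nseq n x)) = act s (flatten (nseq n k)).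
  elim: n s => //= n IH s rs.
  by rewrite !act_cat act_reduction // IH ?reduced_act.
have [p [c [def_k c0 rcc]]] := cyclic_reduction rk k0.
have := bounded N.+1; rewrite act_k // def_k act_conj_power //.
have rpow : reduced (p ++ flatten (nseq N.+1 c) ++ inv_word p).
  by apply: reduced_conj_power; rewrite // -def_k.
rewrite act_reduced catrevE cats0 ?reduced_rev // size_rev !size_cat size_flatten.
have : 0 < size c by rewrite lt0n size_eq0.
rewrite /shape map_nseq sumn_nseq; nia.
Qed.

(** * Green's relation H *)

(** Relation R makes the vertex set T of u that of v.  Relation L
writes u as x v, so that T contains its translate by x, hence every power of
x; as T is finite, x is trivial and both walks end at the same vertex. *)
Lemma green_H_act_trace u v : green_H (FIM_pi u) (FIM_pi v) ->
  act [::] u = act [::] v /\ trace [::] u =i trace [::] v.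
Proof.
case=> eqR eqL.
have right_mult (u' v' : word X) :
    green_R (FIM_pi u') (FIM_pi v') -> exists y, vagner u' (v' ++ y).
  move=> eR; have : [set (FIM_pi u' * x)%g | x in [set: FIM X]]%classic (FIM_pi u').
    by exists 1%g; rewrite ?mulg1.
  rewrite eR => -[y _ def_u]; have [y' def_y] := FIM_pi_surj y.
  by exists y'; apply/FIM_piP; rewrite FIM_piM def_y.
have [y uvy] := right_mult _ _ eqR.
have [z vuz] := right_mult _ _ (esym eqR).
have [x uxv] : exists x, vagner u (x ++ v).
  have : [set (x * FIM_pi u)%g | x in [set: FIM X]]%classic (FIM_pi u).
    by exists 1%g; rewrite ?mul1g.
  rewrite eqL => -[x _ def_u]; have [x' def_x] := FIM_pi_surj x.
  by exists x'; apply/FIM_piP; rewrite FIM_piM def_x.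
(* Stated from every starting vertex s, so that it also compares translates. *)
have tr_uv s : reduced s -> trace s u =i trace s v.
  move=> rs t; apply/idP/idP => tin.
    have [_ ->] := vagner_act_trace vuz rs; by rewrite mem_trace_cat tin.
  have [_ ->] := vagner_act_trace uvy rs; by rewrite mem_trace_cat tin.
have powers n s t : reduced s ->
    t \in trace (act s (flatten (nseq n x))) u -> t \in trace s u.
  elim: n s => //= n IH s rs; rewrite act_cat => /IH.
  move=> /(_ (reduced_act _ rs)); rewrite tr_uv ?reduced_act // => tin.
  by have [_ ->] := vagner_act_trace uxv rs; rewrite mem_trace_cat tin orbT.
have x1 : act [::] x = [::].
  apply: (@bounded_powers_trivial _ (size u)) => n.
  exact/(trace_size (s := [::]))/(powers n)/mem_trace_start.
split; last exact: tr_uv.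
by have [-> _] := vagner_act_trace uxv (isT : reduced [::]); rewrite act_cat x1.
Qed.

(** * Idempotents *)

Definition idempotent_word w := exists t, vagner w (t ++ inv_word t).

Lemma idempotent_word_comm u v :
  idempotent_word u -> idempotent_word v -> vagner (u ++ v) (v ++ u).
Proof.
move=> [t ut] [r vr].
apply: vagner_trans (vagner_cat ut vr) _.
apply: vagner_trans (vagner_sym (vagner_cat vr ut)).
by rewrite -!catA; apply: vagner_comm.
Qed.

Lemma idempotent_word_conj u v : idempotent_word v ->
  idempotent_word (u ++ v ++ inv_word u).
Proof.
move=> [t vt]; exists (u ++ t); rewrite inv_word_cat.
have -> : (u ++ t) ++ inv_word t ++ inv_word u =
   u ++ (t ++ inv_word t) ++ inv_word u by rewrite -!catA.
by do 2![apply: vagner_cat; rewrite //; try exact: vagner_refl].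
Qed.

(** With e = t t^-1 and f = r r^-1, the word e r is a witness for e f: the
product of e r with its inverse is e f e, and idempotents commute. *)
Lemma idempotent_word_cat u v :
  idempotent_word u -> idempotent_word v -> idempotent_word (u ++ v).
Proof.
move=> [t ut] [r vr]; exists (t ++ inv_word t ++ r).
apply: vagner_trans (vagner_cat ut vr) (vagner_sym _).
rewrite !inv_word_cat inv_wordK -!catA.
have -> : t ++ inv_word t ++ r ++ inv_word r ++ t ++ inv_word t =
  (t ++ inv_word t) ++ (r ++ inv_word r ++ t ++ inv_word t) by rewrite -!catA.
apply: vagner_trans (vagner_cat (vagner_refl _) (vagner_comm _ _)) _.
have -> : (t ++ inv_word t) ++ t ++ inv_word t ++ r ++ inv_word r =
  (t ++ inv_word t ++ t) ++ (inv_word t ++ r ++ inv_word r) by rewrite -!catA.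
exact: vagner_cat (vagner_regular _) (vagner_refl _).
Qed.

Lemma idempotent_word_loop a d w : idempotent_word d -> idempotent_word w ->
  idempotent_word (a :: d ++ inv_letter a :: w).
Proof.
move=> id_d id_w; rewrite -cat1s -(cat1s (inv_letter a)) !catA.
apply: idempotent_word_cat id_w; rewrite -catA.
exact: (@idempotent_word_conj [:: a]).
Qed.

(** The walk on the left crosses the edge a three times.  Moving the idempotent e
in front of the idempotent a d a^-1, and then a^-1 a in front of d, leaves the
factor a a^-1 a, which is a. *)
Lemma vagner_shorten a d e p : idempotent_word d -> idempotent_word e ->
  vagner (a :: d ++ inv_letter a :: e ++ a :: p) (e ++ a :: d ++ p).
Proof.
move=> id_d id_e.
have id_ada : idempotent_word (a :: d ++ [:: inv_letter a]).
  exact: (@idempotent_word_conj [:: a]).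
have id_aa : idempotent_word [:: inv_letter a; a].
  by exists [:: inv_letter a]; rewrite /inv_word /= inv_letterK; apply: vagner_refl.
have -> : a :: d ++ inv_letter a :: e ++ a :: p =
  ((a :: d ++ [:: inv_letter a]) ++ e) ++ a :: p by rewrite -!catA /= -!catA.
have eq1 := vagner_cat (idempotent_word_comm id_ada id_e) (vagner_refl (a :: p)).
apply: vagner_trans eq1 _.
have -> : (e ++ a :: d ++ [:: inv_letter a]) ++ a :: p =
  (e ++ [:: a]) ++ (d ++ [:: inv_letter a; a]) ++ p by rewrite -!catA /= -!catA.
have eq2 := vagner_cat (idempotent_word_comm id_d id_aa) (vagner_refl p).
apply: vagner_trans (vagner_cat (vagner_refl _) eq2) _.
have -> : (e ++ [:: a]) ++ ([:: inv_letter a; a] ++ d) ++ p =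
  e ++ [:: a; inv_letter a; a] ++ d ++ p by rewrite -!catA.
apply: vagner_cat (vagner_refl _) _.
exact: vagner_cat (vagner_regular [:: a]) (vagner_refl _).
Qed.

Lemma mem_Geo w : Geo X w <-> forall u, vagner u w -> size w <= size u.
Proof.
split=> [[_ minw] u uw | minw].
  by apply: minw; exists u => //; apply/FIM_piP.
by split=> [|_ [u /FIM_piP/minw uw <-]]; first by exists w.
Qed.

Lemma Geo_cat u v : Geo X (u ++ v) -> Geo X v.
Proof.
rewrite !mem_Geo => minuv v' vv'.
have := minuv _ (vagner_cat (vagner_refl u) vv').
by rewrite !size_cat leq_add2l.
Qed.

End Walks.

(** * The grammar of geodesics *)

Section Grammar.
Variable X : finType.
Local Notation letter := (X + X)%type.
Local Notation full := (finset.setTfor letter).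
Implicit Types (A : {set letter}) (a b : letter) (u v w p d e : word X).

(** The set A holds the letters that may still be used at the current vertex.
Upon arrival along a it is everything but a^-1, so that the edge just crossed
is crossed again only by the return that closes an excursion.  The flag says that the walk must
return to where it starts, which forbids leaving along an edge for good. *)
Inductive geodesic_walk : bool -> {set letter} -> word X -> Prop :=
| walk_nil closed A : geodesic_walk closed A [::]
| walk_loop closed A a d w : a \in A ->
    geodesic_walk true [set~ inv_letter a] d ->
    geodesic_walk closed (A :\ a) w ->
    geodesic_walk closed A (a :: d ++ inv_letter a :: w)
| walk_exit A a w : a \in A ->
    geodesic_walk false [set~ inv_letter a] w ->
    geodesic_walk false A (a :: w).

Lemma closed_walk_idempotent closed A d :
  geodesic_walk closed A d -> closed -> idempotent_word d.
Proof.
elim=> {closed A d} [closed A _ | closed A a d w _ _ IHd _ IHw c | //].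
  by exists [::]; apply: vagner_refl.
by apply: idempotent_word_loop; [exact: IHd | exact: IHw].
Qed.

(** The edge that leads from s towards the identity is not in A, so that every
letter of A leads away from the identity. *)
Definition enters s A := if s is b :: _ then inv_letter b \notin A else true.

Lemma step_enters s A a : enters s A -> a \in A -> step s a = a :: s.
Proof.
case: s => //= b s bA aA; case: eqP => // def_b; case/negP: bA.
by rewrite def_b inv_letterK.
Qed.

Lemma enters_child s a : enters (a :: s) [set~ inv_letter a].
Proof. by rewrite /= !inE eqxx. Qed.

(** The bound of [trace_lower_bound] is attained: at each vertex an edge is used
for at most one excursion, so the excursions visit disjoint subtrees and every
push reaches a new vertex.  The localisation of V behind the letters of A is
what makes the lists of successive excursions disjoint. *)
Lemma geodesic_walk_certificate closed A w : geodesic_walk closed A w ->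
  forall s, enters s A -> (closed -> act s w = s) /\
    exists V : seq (seq letter), [/\ uniq V, V =i trace s w,
      2 * size V + size s = size w + size (act s w) + 2 &
      forall t, t \in V -> t = s \/ exists r a, a \in A /\ t = r ++ a :: s].
Proof.
elim=> {closed A w} [closed A | closed A a d w aA _ IHd _ IHw | A a w aA _ IHw] s sA.
- split=> //; exists [:: s]; split=> //= [|t]; first by lia.
  by rewrite inE => /eqP; left.
- have s_step := step_enters sA aA.
  have [/(_ isT) act_d [V1 [uniq1 tr1 size1 sub1]]] := IHd _ (enters_child s a).
  have sA' : enters s (A :\ a).
    by case: s sA {s_step act_d tr1 size1 sub1} => //= b s; rewrite !inE negb_and orbC => ->.
  have [act_w [V2 [uniq2 tr2 size2 sub2]]] := IHw s sA'.
  have back : step (a :: s) (inv_letter a) = s by rewrite /= inv_letterK eqxx.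
  have act_s : act s (a :: d ++ inv_letter a :: w) = act s w.
    by rewrite [LHS]/= s_step act_cat act_d /= inv_letterK eqxx.
  split=> [c|]; first by rewrite act_s act_w.
  exists (V1 ++ V2); split.
  + rewrite cat_uniq uniq1 uniq2 andbT; apply/hasPn => t /sub2 t2.
    apply/negP => /sub1.
    (* The continuation never goes behind a, since a has been removed from A. *)
    have {t2} t2 : forall r, t <> r ++ a :: s.
      move=> r tr; case: t2 => [|[r2 [b []]]].
        by rewrite tr => /(congr1 size); rewrite size_cat /=; lia.
      rewrite !inE tr => /andP[ba _]; rewrite -!cat_rcons => eq_t.
      have size_eq : size (rcons r a) = size (rcons r2 b).
        by move/(congr1 size): eq_t; rewrite !size_cat => /addIn.
      move/eqP: eq_t; rewrite eqseq_cat // => /andP[/eqP/rcons_inj[_ ab] _].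
      by rewrite ab eqxx in ba.
    case=> [/(t2 [::]) //|[r [b [_]]]].
    by rewrite -cat_rcons => /t2.
  + move=> t; rewrite mem_cat tr1 tr2 mem_trace_cons s_step.
    rewrite mem_trace_cat act_d mem_trace_cons back.
    case: eqP => [->|_]; first by rewrite mem_trace_start orbT.
    case: eqP => [->|_] //; by rewrite mem_trace_start.
  + rewrite act_s size_cat /= size_cat /=; move: size1 size2; rewrite act_d /=; lia.
  + move=> t; rewrite mem_cat => /orP[/sub1|/sub2].
      case=> [->|[r [b [_ ->]]]]; right; first by exists [::], a.
      by exists (rcons r b), a; rewrite cat_rcons.
    case=> [->|[r [b [+ ->]]]]; first by left.
    by rewrite !inE => /andP[_ bA]; right; exists r, b.
- have s_step := step_enters sA aA; split=> //.
  have [_ [V [uniqV trV sizeV subV]]] := IHw _ (enters_child s a).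
  exists (s :: V); split.
  + rewrite /= uniqV andbT; apply/negP => /subV.
    case=> [|[r [b [_]]]] /(congr1 size); rewrite ?size_cat /=; lia.
  + by move=> t; rewrite mem_trace_cons s_step in_cons trV.
  + by rewrite /= s_step; move: sizeV => /=; lia.
  + move=> t; rewrite in_cons => /predU1P[|/subV]; first by left.
    case=> [->|[r [b [_ ->]]]]; right; first by exists [::], a.
    by exists (rcons r b), a; rewrite cat_rcons.
Qed.

Lemma geodesic_walk_min closed A w u : geodesic_walk closed A w ->
  act [::] u = act [::] w -> trace [::] u =i trace [::] w -> size w <= size u.
Proof.
move=> gw eq_act eq_trace.
have [_ [V [uniqV trV sizeV _]]] := geodesic_walk_certificate gw (s := [::]) isT.
apply: (geodesic_certificate eq_act eq_trace uniqV) => [t|].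
  by rewrite trV.
by move: sizeV => /=; lia.
Qed.

(** The edge b at the starting vertex is crossed zero, one or two times.  This
decides what happens when the walk is preceded by a step along the inverse of
b, that is, by a first crossing of that edge. *)
Lemma geodesic_walk_avoid_or_use closed A w b : geodesic_walk closed A w ->
  [\/ geodesic_walk closed (A :\ b) w,
    exists d p, [/\ w = d ++ b :: p, geodesic_walk true (A :\ b) d &
      geodesic_walk false [set~ inv_letter b] p] |
    exists d e p, [/\ w = d ++ b :: e ++ inv_letter b :: p,
      idempotent_word d & idempotent_word e]].
Proof.
elim=> {closed A w} [closed A | closed A a d w aA gd _ gw IHw | A a w aA gw _].
- by constructor 1; constructor.
- have [def_b | ab] := eqVneq a b.
    subst b; constructor 3; exists [::], d, w; split=> //.
      by exists [::]; apply: vagner_refl.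
    exact: closed_walk_idempotent gd isT.
  have aAb : a \in A :\ b by rewrite !inE ab.
  have swap : A :\ a :\ b = A :\ b :\ a by rewrite !finset.setDDl finset.setUC.
  rewrite swap in IHw.
  case: IHw => [gw' | [d' [p [-> gd' gp]]] | [d' [e [p [-> id_d' id_e]]]]].
  + by constructor 1; constructor.
  + constructor 2; exists (a :: d ++ inv_letter a :: d'), p; split=> //.
      by rewrite /= -catA.
    by constructor.
  + constructor 3; exists (a :: d ++ inv_letter a :: d'), e, p; split=> //.
      by rewrite /= -catA.
    exact: idempotent_word_loop (closed_walk_idempotent gd isT) id_d'.
- have [def_b | ab] := eqVneq a b.
    by subst b; constructor 2; exists [::], w; split=> //; constructor.
  by constructor 1; constructor; rewrite // !inE ab.
Qed.

(** Prepend a to a walk of the right shape, and count how often the latter crosses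
the edge a^-1.  If never, the walk leaves along a for good.  If once, the
letter a opens an excursion.  If twice, the word can be shortened, so it was not
geodesic. *)
Lemma Geo_geodesic_walk w : Geo X w -> geodesic_walk false full w.
Proof.
elim: w => [|a w IH] geo_aw; first by constructor.
have {}IH := IH (@Geo_cat _ [:: a] w geo_aw).
case: (geodesic_walk_avoid_or_use (inv_letter a) IH).
- by rewrite finset.setTD => gw; constructor; rewrite // finset.in_setT.
- case=> d [p [def_w gd gp]]; rewrite def_w.
  rewrite finset.setTD in gd; rewrite inv_letterK in gp.
  by constructor; rewrite // ?finset.in_setT ?finset.setTD.
- case=> d [e [p [def_w id_d id_e]]]; move: geo_aw.
  rewrite mem_Geo def_w inv_letterK => minw.
  have := minw _ (vagner_sym (vagner_shorten a p id_d id_e)).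
  by do 4!rewrite ?size_cat /=; lia.
Qed.

Lemma geodesic_walk_HGeo w : geodesic_walk false full w -> HGeo X w.
Proof.
move=> gw; split=> [|_ [u /green_H_act_trace[eq_act eq_trace] <-]].
  by exists w.
exact: geodesic_walk_min gw eq_act eq_trace.
Qed.

Lemma HGeo_Geo w : HGeo X w -> Geo X w.
Proof.
case=> _ minw; apply/mem_Geo => u /FIM_piP uw.
by apply: minw; exists u => //; rewrite /= uw.
Qed.

(** * The grammar as a context-free grammar *)

Local Notation nonterm := (bool * {set letter})%type.
Local Notation form := (seq (nonterm + letter)).

Definition nil_prod (n : nonterm) : nonterm * form := (n, [::]).

Definition loop_prod (q : nonterm * letter) : nonterm * form :=
  let: ((closed, A), a) := q in
  ((closed, A), [:: inr a; inl (true, [set~ inv_letter a]);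
                    inr (inv_letter a); inl (closed, A :\ a)]).

Definition exit_prod (q : {set letter} * letter) : nonterm * form :=
  let: (A, a) := q in
  ((false, A), [:: inr a; inl (false, [set~ inv_letter a])]).

Definition geodesic_prods : seq (nonterm * form) :=
  [seq nil_prod n | n <- enum {: nonterm}] ++
  [seq loop_prod q | q : nonterm * letter <- enum {: nonterm * letter} & q.2 \in q.1.2] ++
  [seq exit_prod q | q : {set letter} * letter <- enum {: {set letter} * letter} & q.2 \in q.1].

Definition geodesic_cfg : cfg letter :=
  @Cfg letter nonterm (false, full) geodesic_prods.

(** The words that a sentential form stands for when each nonterminal is read as
the walks it describes; derivation steps only shrink this language, which
gives soundness of the grammar. *)
Fixpoint yields (f : form) (w : word X) : Prop :=
  match f with
  | [::] => w = [::]
  | inr a :: f' => exists2 w', w = a :: w' & yields f' w'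
  | inl n :: f' => exists u v, [/\ w = u ++ v, geodesic_walk n.1 n.2 u & yields f' v]
  end.

Lemma yields_cat f g w :
  yields (f ++ g) w <-> exists u v, [/\ w = u ++ v, yields f u & yields g v].
Proof.
elim: f w => [|[n|a] f IH] w /=.
- split=> [gw|[u [v [-> -> //]]]]; by exists [::], w.
- split=> [[u [v [-> gu /IH[u' [v' [-> fu' gv']]]]]] | [u' [v' [-> [u [v [-> gu fv] gv']]]]]].
    by exists (u ++ u'), v'; rewrite catA; split=> //; exists u, u'.
  by exists u, (v ++ v'); rewrite catA; split=> //; apply/IH; exists v, v'.
- split=> [[w' -> /IH[u [v [-> fu gv]]]] | [u [v [-> [u' -> fu'] gv]]]].
    by exists (a :: u), v; split=> //; exists u.
  by exists (u' ++ v) => //; apply/IH; exists u', v.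
Qed.

Lemma prod_sound n r w : (n, r) \in geodesic_prods -> yields r w ->
  geodesic_walk n.1 n.2 w.
Proof.
rewrite !mem_cat => /or3P[] /mapP[].
- by move=> m _ [-> ->] /= ->; constructor.
- move=> [[closed A] a]; rewrite mem_filter /= => /andP[aA _] [-> ->] /=.
  case=> w1 -> [d [w2 [-> gd [w3 -> [u [v [-> gu ->]]]]]]].
  by rewrite cats0; constructor.
- move=> [A a]; rewrite mem_filter /= => /andP[aA _] [-> ->] /=.
  case=> w1 -> [u [v [-> gu ->]]].
  by rewrite cats0; constructor.
Qed.

Lemma derives_sound f g w :
  cfg_derives (G := geodesic_cfg) f g -> yields g w -> yields f w.
Proof.
move=> fg; elim: fg w => {f g} [f g [n r s t nr] w | // | f g h _ IH1 _ IH2 w].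
  rewrite !yields_cat => -[u [v [-> su /yields_cat[v1 [v2 [-> rv tv]]]]]].
  exists u, (v1 ++ v2); split=> //=; exists v1, v2; split=> //.
  exact: prod_sound nr rv.
by move/IH2/IH1.
Qed.

Lemma yields_terminals w : yields (map inr w) w.
Proof. by elim: w => //= a w IH; exists w. Qed.

Lemma derives_context s t f g : cfg_derives (G := geodesic_cfg) f g ->
  cfg_derives (G := geodesic_cfg) (s ++ f ++ t) (s ++ g ++ t).
Proof.
elim=> {f g} [_ _ [n r s' t' nr] | f | f g h _ IH1 _ IH2].
- apply: rt_step; rewrite -!catA cat_cons !(catA s s').
  exact: CfgStep nr.
- exact: rt_refl.
- exact: rt_trans IH1 IH2.
Qed.

Lemma derives_prod n r g : (n, r) \in geodesic_prods ->
  cfg_derives (G := geodesic_cfg) r g ->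
  cfg_derives (G := geodesic_cfg) [:: inl n] g.
Proof.
move=> nr; apply: rt_trans; apply: rt_step.
by have := @CfgStep _ geodesic_cfg n r [::] [::] nr; rewrite cats0.
Qed.

Lemma derives_complete closed A w : geodesic_walk closed A w ->
  cfg_derives (G := geodesic_cfg) [:: inl (closed, A)] (map inr w).
Proof.
elim=> {closed A w} [closed A | closed A a d w aA _ IHd _ IHw | A a w aA _ IHw].
- apply: derives_prod (rt_refl _ _ _).
  by rewrite mem_cat; apply/orP; left; apply/mapP; exists (closed, A); rewrite ?mem_enum.
- apply: (@derives_prod _ (loop_prod ((closed, A), a)).2).
    rewrite !mem_cat; apply/or3P/Or32/mapP; exists ((closed, A), a) => //.
    by rewrite mem_filter mem_enum andbT.
  rewrite /= map_cat /=.
  apply: rt_trans (derives_context [:: inr a] [:: inr (inv_letter a); inl (closed, A :\ a)] IHd) _.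
  have := derives_context (inr a :: map inr d ++ [:: inr (inv_letter a)]) [::] IHw.
  by rewrite !cats0 /= -!catA.
- apply: (@derives_prod _ (exit_prod (A, a)).2).
    rewrite !mem_cat; apply/or3P/Or33/mapP; exists (A, a) => //.
    by rewrite mem_filter mem_enum andbT.
  by have := derives_context [:: inr a] [::] IHw; rewrite !cats0.
Qed.

Lemma geodesic_cfg_language w :
  cfg_language geodesic_cfg w <-> geodesic_walk false full w.
Proof.
split=> [der | ]; last exact: derives_complete.
have [u [v [-> gu ->]]] := derives_sound der (yields_terminals w).
by rewrite cats0.
Qed.

End Grammar.

Theorem theorem6p1 (X : finType) :
  HGeo X = Geo X /\ @context_free (X + X)%type (Geo X).
Proof.
split.
  apply/seteqP; split=> w; first exact: HGeo_Geo.
  by move=> /Geo_geodesic_walk/geodesic_walk_HGeo.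
exists (geodesic_cfg X); apply/seteqP; split=> w /=.
  by move/geodesic_cfg_language/geodesic_walk_HGeo/HGeo_Geo.
by move=> /Geo_geodesic_walk geo_w; apply/geodesic_cfg_language.
Qed.
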